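(* Consider the no-CoT case $k=0$, so that the evaluation loss is $$\mathcal L^{\mathrm{Eval}}(V,W)=\tfrac12\,\mathbb E_{X,\mathbf w^*}\Big[\big\|f_{\mathrm{LSA}}(Z_0;V,W)_{[:,-1]}-(0_d,0,\mathbf w^*,1)\big\|^2\Big].$$ If $(V^*,W^* )$ is a global minimizer of $\mathcal L^{\mathrm{Eval}}$, then the corresponding one-layer transformer implements one step of gradient descent from $0$ on the linear least-squares objective with learning rate $\eta^*=\frac{n}{n+d+1}$. That is, it outputs $$f_{\mathrm{LSA}}(Z_0;V^*,W^* )_{[:,-1]}=\Big(0_d,\,0,\,\tfrac{\eta^*}{n}X\mathbf y^\top,\,1\Big).$$
   Context: Let $d,n\ge 1$ and $d_e=2d+2$. Sample $\mathbf w^*\sim\mathcal N(0,I_d)$ and, independently, $\mathbf x_1,\dots,\mathbf x_n$ i.i.d. $\mathcal N(0,I_d)$. Set $y_i=\mathbf w^{*\top}\mathbf x_i$, $X=[\mathbf x_1,\dots,\mathbf x_n]\in\mathbb R^{d\times n}$ and $\mathbf y=(y_1,\dots,y_n)\in\mathbb R^{1\times n}$. For $V,W\in\mathbb R^{d_e\times d_e}$ and a matrix $Z$ with $d_e$ rows, the one-layer linear self-attention model is $f_{\mathrm{LSA}}(Z;V,W)=Z+VZ\,\frac{Z^\top WZ}{n}$. Its prediction is the last column $f_{\mathrm{LSA}}(Z;V,W)_{[:,-1]}$. The input is $$Z_0=\begin{bmatrix}X&0_d\\ \mathbf y&0\\ 0_{d\times n}&\mathbf w_0\\ 0_{1\times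 n}&1\end{bmatrix}\in\mathbb R^{d_e\times(n+1)},\qquad \mathbf w_0=0_d.$$ The goal of the model (in-context weight prediction) is to output $(0_d,0,\mathbf w^*,1)$. *)

(* Defs.v *)
From HB Require Import structures.
From mathcomp Require Import all_boot all_order all_algebra.
From mathcomp Require Import all_classical all_reals all_analysis.
Set Implicit Arguments. Unset Strict Implicit. Unset Printing Implicit Defensive.
Import Order.TTheory GRing.Theory Num.Theory.
Local Open Scope ring_scope.

(* embedding dimension d_e = 2d+2, written as (d+1)+(d+1) so that block
   matrices typecheck *)
Definition de (d : nat) : nat := ((d + 1) + (d + 1))%N.

Section LSA.
Variable R : realType.

Definition labels d n (X : 'M[R]_(d, n)) (wstar : 'cV[R]_d) : 'M[R]_(1, n) :=
  wstar^T *m X.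

(* input matrix Z_0 with w_0 = 0_d *)
Definition Z0 d n (X : 'M[R]_(d, n)) (wstar : 'cV[R]_d) : 'M[R]_(de d, n + 1) :=
  col_mx (col_mx (row_mx X 0) (row_mx (labels X wstar) 0))
         (col_mx (row_mx 0 (0 : 'cV[R]_d)) (row_mx 0 (const_mx 1))).

Definition fLSA m k n (V W : 'M[R]_m) (Z : 'M[R]_(m, k)) : 'M[R]_(m, k) :=
  Z + (n%:R)^-1 *: (V *m Z *m (Z^T *m W *m Z)).

Definition prediction d n (V W : 'M[R]_(de d)) (X : 'M[R]_(d, n))
  (wstar : 'cV[R]_d) : 'cV[R]_(de d) :=
  col (rshift n (ord0 : 'I_1)) (fLSA n V W (Z0 X wstar)).

Definition target d (wstar : 'cV[R]_d) : 'cV[R]_(de d) :=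
  col_mx (col_mx 0 0) (col_mx wstar (const_mx 1)).

Definition sqnorm m (v : 'cV[R]_m) : R := \sum_i v i 0 ^+ 2.

(* Expectation of f(g) where g : nat -> R has coordinates 0..k-1 i.i.d.
   standard normal (iterated integrals against N(0,1)); coordinates >= k
   are set to 0 and are unused. *)
Fixpoint gauss_expect (k : nat) (f : (nat -> R) -> \bar R) : \bar R :=
  match k with
  | 0 => f (fun _ => 0)
  | k'.+1 => (\int[normal_prob (0:R) 1]_x
                gauss_expect k' (fun g => f (fun i => if i == k' then x else g i)))%E
  end.

(* X_{ij} = g (i*n + j), w*_i = g (d*n + i) : all d*n + d entries i.i.d. N(0,1) *)
Definition X_of d n (g : nat -> R) : 'M[R]_(d, n) := \matrix_(i, j) g (i * n + j)%N.
Definition w_of d n (g : nat -> R) : 'cV[R]_d := \col_i g (d * n + i)%N.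

Definition LEval d n (V W : 'M[R]_(de d)) : \bar R :=
  gauss_expect (d * n + d)
    (fun g => ((2%:R)^-1 *
       sqnorm (prediction V W (X_of d n g) (w_of d n g) - target (w_of d n g)))%:E).

End LSA.

(* Main.v *)
Require Import Defs.
From HB Require Import structures.
From mathcomp Require Import all_boot all_order all_algebra.
From mathcomp Require Import all_classical all_reals all_analysis.
From mathcomp Require Import measurable_realfun ring lra zify.
Import Order.TTheory GRing.Theory Num.Theory.
Import numFieldNormedType.Exports.
Local Open Scope ring_scope.
Set Implicit Arguments. Unset Strict Implicit. Unset Printing Implicit Defensive.

(** With [G = X X^T], every coordinate of the prediction lies in the span of [1],
    the entries of [G], the coordinates of [G w] and [w^T G w]. The residual of the
    gradient step, [G w / (n + d + 1) - w], is orthogonal in L^2 to this span: the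
    functions that are even in [w] are orthogonal by parity, and for [G w] this is
    [E G = n I] and [E G^2 = n (n + d + 1) I]. Hence the loss of any model is the
    loss of the gradient step plus half the mean squared distance of the two
    predictions. At a minimizer this distance vanishes, and a polynomial with zero
    Gaussian second moment is identically zero. All moments come from Gaussian
    integration by parts, [E (g_i f) = E (d_i f)]. *)

(** * Gaussian integrals of univariate polynomials *)

Section gauss1.
Local Open Scope classical_set_scope.
Variable R : realType.
Implicit Types (p q : {poly R}) (x : R).
Notation mu := (@lebesgue_measure R).
Notation N01 := (@normal_prob R 0 1).
Notation pdf := (@normal_pdf R 0 1).

(** The density and the Radon-Nikodym derivative of [N01] have the same integral over every
    measurable set, so they agree almost everywhere and may be exchanged under the integral. *)
Lemma ge0_integral_normal_prob (f : R -> \bar R) :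
  measurable_fun setT f -> (forall x, 0 <= f x)%E ->
  (\int[N01]_x f x = \int[mu]_x (f x * (pdf x)%:E))%E.
Proof.
move=> mf f0.
rewrite -(Radon_Nikodym_SigmaFinite.change_of_variables (@normal_prob_dominates R 0 1))//=.
have domN := @normal_prob_dominates R 0 1.
apply: ae_eq_integral => //.
- apply: emeasurable_funM => //; apply: (measurable_int mu).
  exact: Radon_Nikodym_SigmaFinite.f_integrable.
- apply: emeasurable_funM => //=.
  by apply/measurable_EFinP; exact: measurable_normal_pdf.
- apply: ae_eqe_mul2l => /=.
  apply: integral_ae_eq => //=.
  + exact: Radon_Nikodym_SigmaFinite.f_integrable.
  + by apply/measurable_EFinP; exact: measurable_normal_pdf.
  + by move=> E _ mE; rewrite -Radon_Nikodym_SigmaFinite.f_integral.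
Qed.

(** The density is nonnegative, so multiplying by it commutes with taking positive and negative
    parts. *)
Lemma integral_normal_prob (f : R -> R) : measurable_fun setT f ->
  (\int[N01]_x (f x)%:E = \int[mu]_x (f x * pdf x)%:E)%E.
Proof.
move=> mf; have /measurable_EFinP mf' := mf.
rewrite integralE [RHS]integralE; congr (_ - _)%E.
- rewrite ge0_integral_normal_prob //; last exact: measurable_funepos.
  apply: eq_integral => x _ /=.
  by rewrite !funeposE /= maxe_pMl ?lee_fin ?normal_pdf_ge0// mul0e.
- rewrite ge0_integral_normal_prob //; last exact: measurable_funeneg.
  apply: eq_integral => x _ /=.
  by rewrite !funenegE /= maxe_pMl ?lee_fin ?normal_pdf_ge0// mul0e -EFinM mulNr.
Qed.

Lemma std_normal_pdfE x : pdf x = normal_peak 1 * expR (- x ^+ 2 / 2).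
Proof. by rewrite normal_pdfE ?oner_neq0// /normal_fun subr0 expr1n. Qed.

(** The rate [x ^+ 2 / 4] is half of the Gaussian exponent: against the density, a factor
    [expR (- x ^+ 2 / 4)] survives and gives both integrability and decay. *)
Lemma horner_expR_le p : exists2 C : R, 0 <= C &
  forall x, `|p.[x]| <= C * expR (x ^+ 2 / 4).
Proof.
have mono i : exists2 C : R, 0 <= C & forall x, `|x| ^+ i <= C * expR (x ^+ 2 / 4).
  case: i => [|i].
    by exists 1 => // x; rewrite expr0 mul1r -expR0 ler_expR divr_ge0 ?sqr_ge0.
  (* [|x| <= 1 + x ^+ 2], and the term of order [i.+1] of the exponential series at
     [(1 + x ^+ 2) / 4] bounds its power; [expR (1 / 4)] pays for the added 1. *)
  exists (4 ^+ i.+1 * i.+1`!%:R * expR (1 / 4)) => [|x].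
    by rewrite !mulr_ge0 ?expR_ge0 ?exprn_ge0.
  rewrite -mulrA -expRD -mulrDl.
  have x2 : 0 <= x ^+ 2 by exact: sqr_ge0.
  have y0 : 0 <= (1 + x ^+ 2) / 4 by lra.
  have /(le_trans _)->// : 4 ^+ i.+1 * i.+1`!%:R * (1 + ((1 + x ^+ 2) / 4) ^+ i.+1 / i.+1`!%:R)
     <= 4 ^+ i.+1 * i.+1`!%:R * expR ((1 + x ^+ 2) / 4).
    by rewrite ler_wpM2l ?mulr_ge0 ?exprn_ge0// expR_ge1Dxn.
  rewrite mulrDr mulr1 ler_wpDl ?mulr_ge0 ?exprn_ge0//.
  rewrite expr_div_n [X in _ <= X](_ : _ = (1 + x ^+ 2) ^+ i.+1); last first.
    by field; rewrite pnatr_eq0 -lt0n fact_gt0 /= expf_neq0.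
  rewrite lerXn2r ?nnegrE ?normr_ge0//; first by lra.
  have := sqr_ge0 (`|x| - 1); have := normr_ge0 x; rewrite -(real_normK (num_real x)).
  by nra.
have [C C0 HC] : exists2 C : nat -> R, (forall i, 0 <= C i) &
    forall i x, `|x| ^+ i <= C i * expR (x ^+ 2 / 4).
  have /choice[C HC] : forall i, exists C : R, 0 <= C /\
      forall x, `|x| ^+ i <= C * expR (x ^+ 2 / 4).
    by move=> i; have [C] := mono i; exists C.
  by exists C => i; have [] := HC i.
exists (\sum_(i < size p) `|p`_i| * C i) => [|x].
  by apply: sumr_ge0 => i _; rewrite mulr_ge0.
rewrite horner_coef mulr_suml (le_trans (ler_norm_sum _ _ _))//.
by apply: ler_sum => i _; rewrite normrM normrX -mulrA ler_wpM2l// HC.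
Qed.

Lemma integrable_horner_pdf p :
  mu.-integrable setT (fun x => (p.[x] * pdf x)%:E).
Proof.
have [C C0 HC] := horner_expR_le p.
have s2 : Num.sqrt 2 != 0 :> R by rewrite gt_eqF// sqrtr_gt0.
(* After the bound of [horner_expR_le] the product has the shape of the normal density of variance
   2; [K] exchanges the two normalizing constants. *)
pose K : R := C * normal_peak 1 / normal_peak (Num.sqrt 2).
have K0 : 0 <= K by rewrite !mulr_ge0 ?invr_ge0 ?normal_peak_ge0.
apply: (le_integrable _ _ _ (integrableZl _ K (integrable_normal_pdf 0 (Num.sqrt 2)))) => //.
- apply/measurable_EFinP; apply: measurable_funM; first exact: measurable_poly.
  exact: measurable_normal_pdf.
- move=> x _ /=; rewrite lee_fin normrM [X in _ * X]ger0_norm ?normal_pdf_ge0//.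
  rewrite [leRHS]ger0_norm; last by rewrite mulr_ge0 ?normal_pdf_ge0.
  rewrite std_normal_pdfE normal_pdfE// /normal_fun subr0 sqr_sqrtr//.
  have := normal_peak_gt0 s2; set s := normal_peak _ => sgt0.
  rewrite [leRHS](_ : _ = C * expR (x ^+ 2 / 4) * (normal_peak 1 * expR (- x ^+ 2 / 2))).
    by apply: ler_wpM2r; rewrite ?mulr_ge0 ?expR_ge0 ?normal_peak_ge0.
  rewrite [RHS]mulrACA -expRD /K.
  rewrite (_ : x ^+ 2 / 4 + - x ^+ 2 / 2 = - x ^+ 2 / (2 *+ 2)); last first.
    by rewrite -mulr_natr; field.
  by rewrite -/s; field; rewrite gt_eqF.
Qed.

Lemma integrable_normal_horner p : N01.-integrable setT (EFin \o horner p).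
Proof.
apply/integrableP; split; first by apply/measurable_EFinP; exact: measurable_poly.
have /integrableP[_] := integrable_horner_pdf p.
rewrite ge0_integral_normal_prob //.
  under eq_integral do rewrite EFinM abseM.
  congr (_ < _)%E; apply: eq_integral => x _; congr (_ * _)%E.
  by rewrite /= ger0_norm ?normal_pdf_ge0.
by apply: measurableT_comp => //; apply/measurable_EFinP; exact: measurable_poly.
Qed.

Definition gint p : R := fine (\int[N01]_x (p.[x])%:E)%E.

Lemma gintE p : (\int[N01]_x (p.[x])%:E)%E = (gint p)%:E.
Proof.
rewrite /gint fineK//; apply: integrable_fin_num => //.
exact: integrable_normal_horner.
Qed.

Lemma gintD p q : gint (p + q) = gint p + gint q.
Proof.
apply: EFin_inj; rewrite EFinD -!gintE.
under eq_integral do rewrite hornerD EFinD.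
by rewrite integralD//; exact: integrable_normal_horner.
Qed.

Lemma gintZ c p : gint (c *: p) = c * gint p.
Proof.
apply: EFin_inj; rewrite EFinM -!gintE.
under eq_integral do rewrite hornerZ EFinM.
by rewrite integralZl//; exact: integrable_normal_horner.
Qed.

Lemma gint1 : gint 1 = 1.
Proof.
apply: EFin_inj; rewrite -gintE.
under eq_integral do rewrite hornerE.
rewrite integral_cst//= mul1e; exact: probability_setT.
Qed.

(** The integrand vanishes outside a null set. If [p] were nonzero, its finitely many roots would
    form a null set too, and two null sets would cover the line, against total mass 1. *)
Lemma gint_eq0 p : (forall x, 0 <= p.[x]) -> gint p = 0 -> p = 0.
Proof.
move=> p0 Ip; apply/eqP/negPn/negP => pn0.
have : (\int[N01]_x `| (p.[x])%:E |)%E = 0%E.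
  transitivity (\int[N01]_x (p.[x])%:E)%E; last by rewrite gintE Ip.
  by apply: eq_integral => x _; rewrite gee0_abs ?lee_fin.
move/(ae_eq_integral_abs N01 measurableT _).
case; first by apply/measurable_EFinP; exact: measurable_poly.
move=> A [mA A0 sub].

have mZ : measurable [set x | p.[x] = 0].
  rewrite (_ : [set x | _] = horner p @^-1` [set 0])//.
  by rewrite -[X in measurable X]setTI; exact: measurable_poly.
have Z0 : N01 [set x | p.[x] = 0] = 0%E.
  have /null_content_dominatesP := @normal_prob_dominates R 0 1.
  apply => //.
  apply: countable_lebesgue_measure0; apply: finite_set_countable.
  apply: contrapT => /(infinite_set_fset (size p)) [B BZ].
  rewrite leqNgt max_poly_roots //; last exact: finmap.fset_uniq.
  by apply/allP => x /BZ /eqP.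
have : (N01 setT <= N01 (A `|` [set x | p.[x] = 0%R]))%E.
  apply: le_measure; rewrite ?inE//; first exact: measurableU.
  move=> x _ /=; have [px|px] := eqVneq p.[x] 0; [by right|left].
  by apply: sub => /= /(_ I) [px0]; rewrite px0 eqxx in px.
rewrite probability_setT measureU0// A0 => /=.
by rewrite lee_fin ler10.
Qed.

Lemma is_derive_horner_expR p q x :
  is_derive x 1 (fun x => p.[x] * expR q.[x]) ((p^`() + p * q^`()).[x] * expR q.[x]).
Proof.
have dp : is_derive x (1 : R) (horner p) p^`().[x] by exact: is_derive_poly.
have dq : is_derive x (1 : R) (horner q) q^`().[x] by exact: is_derive_poly.
have de := is_derive1_comp (is_derive_expR q.[x]) dq.
have := is_deriveM dp de.
set D1 := (D in is_derive _ _ _ D -> _).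
move=> H; rewrite [X in is_derive _ _ _ X](_ : _ = D1)//.
by rewrite /D1 !hornerE /= /GRing.scale /=; ring.
Qed.


(** Follows from [expR t >= 1 + t] at [t = x ^+ 2 / 4]. This decay is enough to kill the boundary
    terms of the integration by parts. *)
Lemma horner_pdf_le p : exists2 K : R, 0 <= K &
  forall x, x != 0 -> `|p.[x] * pdf x| <= K / x ^+ 2.
Proof.
have [C C0 HC] := horner_expR_le p.
have pk0 := @normal_peak_ge0 R 1.
exists (C * normal_peak 1 * 4) => [|x x0]; first by rewrite !mulr_ge0.
rewrite std_normal_pdfE normrM [X in _ * X]ger0_norm ?mulr_ge0 ?expR_ge0//.
apply: (le_trans (ler_wpM2r _ (HC x))); first by rewrite mulr_ge0 ?expR_ge0.
rewrite mulrACA -expRD -[leRHS]mulrA ler_wpM2l ?mulr_ge0//.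
rewrite (_ : x ^+ 2 / 4 + - x ^+ 2 / 2 = - (x ^+ 2 / 4)); last by field.
have x2 : 0 < x ^+ 2 by rewrite exprn_even_gt0.
rewrite expRN -[4 / _]invf_div lef_pV2 ?posrE ?expR_gt0 ?divr_gt0//.
by have := expR_ge1Dx (x ^+ 2 / 4); lra.
Qed.

Lemma continuous_pdf : continuous pdf.
Proof. by apply: continuous_normal_pdf; rewrite oner_neq0. Qed.

(** The derivative of [p.[x] * pdf x] is [P.[x] * pdf x], with [P] standing for p' - x p. So the
    integral over a bounded interval is a boundary term, which tends to 0 as the interval grows. *)
Lemma gint_deriv p : gint p^`() = gint ('X * p).
Proof.
apply/eqP; rewrite -subr_eq0 -mulN1r -gintZ -gintD; apply/eqP.
apply: EFin_inj; rewrite -gintE integral_normal_prob; last exact: measurable_poly.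
set P := _ + _.
pose h := fun x => (P.[x] * pdf x)%:E.
(* With [n.+1] instead of [n] the interval is never degenerate, and the endpoints are nonzero as
   [horner_pdf_le] demands. *)
pose f n := h \_ (`[- n.+1%:R, n.+1%:R]%classic : set R).
have mh : measurable_fun setT h by exact: measurable_int (integrable_horner_pdf P).
have cvgf : (\int[mu]_x f n x)%E @[n --> \oo] --> (\int[mu]_x h x)%E.
  apply: (let: And3 _ _ H := @dominated_convergence _ _ _ mu setT measurableT
    f h (abse \o h) _ _ _ _ _ in H).
  - move=> n; apply/(measurable_restrictT _ _).1 => //.
    exact: measurable_funTS.
  - exact: mh.
  - apply: aeW => x _; apply: cvg_near_cst.
    near=> n; rewrite /f patchE ifT// inE/= in_itv/= -ler_norml.
    near: n; exists (Num.bound `|x|) => // n /= nx.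
    rewrite (le_trans (ltW (archi_boundP (normr_ge0 x))))// ler_nat.
    exact: (leq_trans nx).
  - exact: integrable_abse (integrable_horner_pdf P).
  - apply: aeW => x n _; rewrite /f patchE; case: ifP => //= _.
    by rewrite normr0 lee_fin.
have ftc n : (\int[mu]_x f n x)%E =
    (p.[n.+1%:R] * pdf n.+1%:R - p.[- n.+1%:R] * pdf (- n.+1%:R))%:E.
  rewrite /f -integral_mkcond EFinB.
  have dF x : is_derive x (1 : R) (fun x => p.[x] * pdf x) (P.[x] * pdf x).
    pose q : {poly R} := (- 2^-1) *: 'X^2.
    have qE y : expR q.[y] = expR (- y ^+ 2 / 2).
      by rewrite hornerZ hornerXn; congr expR; field.
    have := is_derive_horner_expR (normal_peak 1 *: p) q x.
    congr is_derive; first by apply/funext => y; rewrite std_normal_pdfE qE hornerZ; ring.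
    have qd : q^`().[x] = - x.
      by rewrite /q derivZ derivXn hornerZ hornerMn hornerXn -mulr_natr; field.
    rewrite qE std_normal_pdfE /P derivZ !(hornerD, hornerZ, hornerM, hornerX) qd; ring.
  apply: (@continuous_FTC2 R (fun x => P.[x] * pdf x) (fun x => p.[x] * pdf x)).
  - by rewrite gtrN.
  - apply: continuous_subspaceT => x; apply: cvgM; last exact: continuous_pdf.
    exact: continuous_horner.
  - have cF x : {for x, continuous (fun x => p.[x] * pdf x)}.
      by apply: cvgM; [exact: continuous_horner|exact: continuous_pdf].
    split.
    + by move=> x _; have [] := dF x.
    + by apply: cvg_at_right_filter; exact: cF.
    + by apply: cvg_at_left_filter; exact: cF.
  - by move=> x _; rewrite derive1E; have [_ ->] := dF x.
have cvg0 : (\int[mu]_x f n x)%E @[n --> \oo] --> (0%:E : \bar R).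
  have [K K0 HK] := horner_pdf_le p.
  under eq_fun do rewrite ftc.
  apply/fine_cvgP; split; first by apply: nearW.
  have -> : fine \o (fun n => (p.[n.+1%:R] * pdf n.+1%:R -
      p.[- n.+1%:R] * pdf (- n.+1%:R))%:E) =
    (fun n => p.[n.+1%:R] * pdf n.+1%:R - p.[- n.+1%:R] * pdf (- n.+1%:R)) by [].
  have K2 : K *+ 2 * harmonic n @[n --> \oo] --> (0 : R).
    by rewrite -[X in _ --> X](mulr0 (K *+ 2)); apply: cvgM;
      [exact: cvg_cst|exact: cvg_harmonic].
  apply/cvgr0Pnorm_le => e e0.
  move/cvgr0Pnorm_le : K2 => /(_ e e0); apply: filterS => n; apply: le_trans.
  have nn0 : n.+1%:R != 0 :> R by rewrite pnatr_eq0.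
  rewrite [leRHS]ger0_norm; last by rewrite mulr_ge0 ?mulrn_wge0// harmonic_ge0.
  apply: (le_trans (ler_normB _ _)).
  apply: (le_trans (lerD (HK _ nn0) (HK _ _))); first by rewrite oppr_eq0.
  rewrite sqrrN mulrnAl -mulr2n lerMn2r /= ler_wpM2l// lef_pV2 ?posrE ?exprn_gt0//.
  by rewrite -natrX ler_nat expnS expn1 leq_pmulr.
exact: (cvg_unique (@ereal_hausdorff R) cvgf cvg0).
Unshelve. all: by end_near. Qed.

End gauss1.

(** * Polynomial functions of independent Gaussians *)

Section gpoly.
Variable R : realType.
Implicit Types (g : nat -> R) (f h : (nat -> R) -> R) (i j k : nat).

Definition upd g i x : nat -> R := fun j => if j == i then x else g j.

(** Generated by rules rather than by a representation, so that facts on polynomial functions follow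
    by structural induction. *)
Inductive gpoly : ((nat -> R) -> R) -> Prop :=
| gpoly_cst c : gpoly (fun=> c)
| gpoly_var i : gpoly (fun g => g i)
| gpolyD f h : gpoly f -> gpoly h -> gpoly (fun g => f g + h g)
| gpolyM f h : gpoly f -> gpoly h -> gpoly (fun g => f g * h g).

(** A relation, because a function does not carry the expression from which its formal derivative is
    computed. *)
Inductive pderiv i : ((nat -> R) -> R) -> ((nat -> R) -> R) -> Prop :=
| pderiv_cst c : pderiv i (fun=> c) (fun=> 0)
| pderiv_var j : pderiv i (fun g => g j) (fun=> (j == i)%:R)
| pderivD f f' h h' : pderiv i f f' -> pderiv i h h' ->
    pderiv i (fun g => f g + h g) (fun g => f' g + h' g)
| pderivM f f' h h' : pderiv i f f' -> pderiv i h h' ->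
    pderiv i (fun g => f g * h g) (fun g => f' g * h g + f g * h' g).

Lemma gpoly_ext f h : gpoly f -> f =1 h -> gpoly h.
Proof. by move=> + /funext <-. Qed.

Lemma pderiv_ext i f f' h : pderiv i f f' -> f' =1 h -> pderiv i f h.
Proof. by move=> + /funext <-. Qed.

Lemma gpolyZ c f : gpoly f -> gpoly (fun g => c * f g).
Proof. by move=> ?; apply: gpolyM => //; exact: gpoly_cst. Qed.

Lemma gpolyB f h : gpoly f -> gpoly h -> gpoly (fun g => f g - h g).
Proof.
move=> gf gh; apply: (gpoly_ext (gpolyD gf (gpolyZ (-1) gh))) => g.
by rewrite mulN1r.
Qed.

Lemma gpoly_sum (I : Type) (r : seq I) (F : I -> (nat -> R) -> R) :
  (forall a, gpoly (F a)) -> gpoly (fun g => \sum_(a <- r) F a g).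
Proof.
move=> gF; elim: r => [|a r IH].
  by apply: (gpoly_ext (gpoly_cst 0)) => g; rewrite big_nil.
by apply: (gpoly_ext (gpolyD (gF a) IH)) => g; rewrite big_cons.
Qed.

Lemma pderiv_gpoly i f f' : pderiv i f f' -> gpoly f.
Proof.
by elim=> *; [exact: gpoly_cst|exact: gpoly_var|exact: gpolyD|exact: gpolyM].
Qed.

Lemma gpoly_pderiv i f : gpoly f -> exists f', pderiv i f f'.
Proof.
elim=> {f} [c|j|f h _ [f' ?] _ [h' ?]|f h _ [f' ?] _ [h' ?]].
- by eexists; exact: pderiv_cst.
- by eexists; exact: pderiv_var.
- by eexists; apply: pderivD; eassumption.
- by eexists; apply: pderivM; eassumption.
Qed.

Lemma pderiv_sum i (I : Type) (r : seq I) (F F' : I -> (nat -> R) -> R) :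
  (forall a, pderiv i (F a) (F' a)) ->
  pderiv i (fun g => \sum_(a <- r) F a g) (fun g => \sum_(a <- r) F' a g).
Proof.
move=> dF; elim: r => [|a r IH].
  rewrite (_ : (fun g => _) = fun=> 0); last by apply/funext => g; rewrite big_nil.
  by apply: pderiv_ext (pderiv_cst _ _) _ => g; rewrite big_nil.
rewrite (_ : (fun g => _) = fun g => F a g + \sum_(a <- r) F a g).
  by apply: pderiv_ext (pderivD (dF a) IH) _ => g; rewrite big_cons.
by apply/funext => g; rewrite big_cons.
Qed.

Lemma gpoly_upd k x f : gpoly f -> gpoly (fun g => f (upd g k x)).
Proof.
elim=> {f} [c|j|f h _ ? _ ?|f h _ ? _ ?].
- exact: gpoly_cst.
- by rewrite /upd; case: eqP => _; [exact: gpoly_cst|exact: gpoly_var].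
- exact: gpolyD.
- exact: gpolyM.
Qed.

Lemma pderiv_upd i k x f f' : i != k -> pderiv i f f' ->
  pderiv i (fun g => f (upd g k x)) (fun g => f' (upd g k x)).
Proof.
move=> ik; elim=> {f f'} [c|j|f f' h h' _ ? _ ?|f f' h h' _ ? _ ?].
- exact: pderiv_cst.
- rewrite /upd; case: eqVneq => [->|_]; last exact: pderiv_var.
  by apply: pderiv_ext (pderiv_cst _ _) _ => g; rewrite eq_sym (negbTE ik).
- exact: pderivD.
- exact: pderivM.
Qed.

(* In one coordinate, a polynomial function is a univariate polynomial whose
   coefficients are polynomial functions, and [pderiv] is [deriv]. *)
Lemma pderiv_slice i f f' : pderiv i f f' ->
  exists N (c : nat -> (nat -> R) -> R),
  [/\ forall j, gpoly (c j),
      forall g x, f (upd g i x) = (\sum_(j < N) c j g *: 'X^j).[x] &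
      forall g x, f' (upd g i x) = (\sum_(j < N) c j g *: 'X^j)^`().[x]].
Proof.
(* [N] bounds the size of [P g] uniformly in [g], so that the coefficients fit in one sum of fixed
   length. *)
move=> ff'; suff [N [P [szP gP fP f'P]]] : exists N (P : (nat -> R) -> {poly R}),
  [/\ forall g, (size (P g) <= N)%N, forall j, gpoly (fun g => (P g)`_j),
      forall g x, f (upd g i x) = (P g).[x] &
      forall g x, f' (upd g i x) = (P g)^`().[x]].
  have PE g : P g = \sum_(j < N) (P g)`_j *: 'X^j.
    rewrite -poly_def; apply/polyP => j; rewrite coef_poly; case: ltnP => // Nj.
    by rewrite nth_default// (leq_trans _ Nj).
  by exists N, (fun j g => (P g)`_j); split=> // g x; rewrite -PE.
elim: ff' => {f f'}.
- move=> c; exists 1%N, (fun=> c%:P); split=> [g|j|g x|g x].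
  + exact: size_polyC_leq1.
  + exact: gpoly_cst.
  + by rewrite hornerC.
  + by rewrite derivC horner0.
- move=> j; have [->|ji] := eqVneq j i.
    exists 2%N, (fun=> 'X); split=> [g|j'|g x|g x].
    + by rewrite size_polyX.
    + exact: gpoly_cst.
    + by rewrite hornerX /upd eqxx.
    + by rewrite derivX hornerC.
  exists 1%N, (fun g => (g j)%:P); split=> [g|j'|g x|g x].
  + exact: size_polyC_leq1.
  + have [->|j0] := eqVneq j' 0%N.
      by apply: gpoly_ext (gpoly_var j) _ => g; rewrite coefC.
    by apply: gpoly_ext (gpoly_cst 0) _ => g; rewrite coefC (negbTE j0).
  + by rewrite hornerC /upd (negbTE ji).
  + by rewrite derivC horner0.
- move=> f f' h h' _ [N [P [szP gP fP f'P]]] _ [M [Q [szQ gQ hQ h'Q]]].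
  exists (maxn N M), (fun g => P g + Q g); split=> [g|j|g x|g x].
  + rewrite (leq_trans (size_polyD _ _))// geq_max !leq_max szP szQ orbT.
    by [].
  + by apply: gpoly_ext (gpolyD (gP j) (gQ j)) _ => g; rewrite coefD.
  + by rewrite hornerD fP hQ.
  + by rewrite derivD hornerD f'P h'Q.
- move=> f f' h h' _ [N [P [szP gP fP f'P]]] _ [M [Q [szQ gQ hQ h'Q]]].
  exists (N + M)%N, (fun g => P g * Q g); split=> [g|j|g x|g x].
  + rewrite (leq_trans (size_polyMleq _ _))// (leq_trans (leq_pred _))//.
    exact: leq_add.
  + apply: (@gpoly_ext (fun g => \sum_(l < j.+1) (P g)`_l * (Q g)`_(j - l))).
      by apply: gpoly_sum => l; exact: gpolyM.
    by move=> g; rewrite coefM.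
  + by rewrite hornerM fP hQ.
  + by rewrite derivM hornerD !hornerM fP hQ f'P h'Q.
Qed.

(** Real-valued form of [gauss_expect]; on polynomial functions [fine] loses nothing, by
    [gauss_expectE]. *)
Fixpoint gE k f : R :=
  if k is k'.+1 then
    fine (\int[normal_prob (0 : R) 1]_x (gE k' (fun g => f (upd g k' x)))%:E)%E
  else f (fun=> 0).

Lemma gE_ge0 k f : (forall g, 0 <= f g) -> 0 <= gE k f.
Proof.
elim: k f => [|k IH] f f0 /=; first exact: f0.
apply: fine_ge0; apply: integral_ge0 => x _; rewrite lee_fin.
by apply: IH => g; exact: f0.
Qed.

(* Linearity in dimension [k] is what the passage to dimension [k.+1] needs, as it
   makes [gE k] of a slice a polynomial; [gE_linear] discharges it. *)
Definition gE_linear_at k :=  forall f h (a : R), gpoly f -> gpoly h ->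
  gE k (fun g => a * f g + h g) = a * gE k f + gE k h.

Lemma gE_linear_at_sum k (I : Type) (r : seq I) (F : I -> (nat -> R) -> R) (a : I -> R) :
  gE_linear_at k -> (forall b, gpoly (F b)) ->
  gE k (fun g => \sum_(b <- r) a b * F b g) = \sum_(b <- r) a b * gE k (F b).
Proof.
move=> lin gF; elim: r => [|b r IH].
  (* Linearity with coefficient -1 at the zero function shows that its expectation is 0. *)
  rewrite big_nil -[RHS](addNr (gE k (fun=> 0))) -mulN1r -lin; try exact: gpoly_cst.
  by congr gE; apply/funext => g; rewrite big_nil mulr0 addr0.
rewrite big_cons -IH -lin//; last by apply: gpoly_sum => c; exact: gpolyZ.
by congr gE; apply/funext => g; rewrite big_cons.
Qed.

(** Averaging the coefficients of the slice over the lower coordinates gives those of [Q].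
    Differentiation in coordinate [k] acts on the powers only, so one [Q] serves both claims. *)
Lemma gE_linear_at_slice k f f' : gE_linear_at k -> pderiv k f f' ->
  exists Q : {poly R}, (forall x, gE k (fun g => f (upd g k x)) = Q.[x]) /\
    (forall x, gE k (fun g => f' (upd g k x)) = Q^`().[x]).
Proof.
move=> lin /pderiv_slice[N [c [gc fc f'c]]].
exists (\sum_(j < N) gE k (c j) *: 'X^j); split=> x.
  rewrite horner_sum.
  under [RHS]eq_bigr do rewrite hornerZ mulrC.
  rewrite -(@gE_linear_at_sum _ _ _ (fun j : 'I_N => c j)) //; congr gE; apply/funext => g.
  by rewrite fc horner_sum; apply: eq_bigr => j _; rewrite hornerZ mulrC.
rewrite raddf_sum horner_sum.
under [RHS]eq_bigr do rewrite /= derivZ hornerZ mulrC.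
rewrite -(@gE_linear_at_sum _ _ _ (fun j : 'I_N => c j)) //; congr gE; apply/funext => g.
by rewrite f'c raddf_sum horner_sum; apply: eq_bigr => j _; rewrite /= derivZ hornerZ mulrC.
Qed.

(** By induction on the dimension: the inner expectations are univariate polynomials in the last
    coordinate, on which [gint] is linear. *)
Lemma gE_linear k f h (a : R) : gpoly f -> gpoly h ->
  gE k (fun g => a * f g + h g) = a * gE k f + gE k h.
Proof.
elim: k f h a => [//|k IH] f h a gf gh /=.
have [f' df] := gpoly_pderiv k gf; have [h' dh] := gpoly_pderiv k gh.
have [P [fP _]] := gE_linear_at_slice IH df; have [Q [hQ _]] := gE_linear_at_slice IH dh.
under eq_integral do rewrite
  (IH _ _ _ (gpoly_upd _ _ gf) (gpoly_upd _ _ gh)) fP hQ -hornerZ -hornerD.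
under [X in _ = _ * fine X + _]eq_integral do rewrite fP.
under [X in _ = _ + fine X]eq_integral do rewrite hQ.
by rewrite !gintE /= gintD gintZ.
Qed.

Lemma gE_cst0 k : gE k (fun=> 0) = 0.
Proof.
rewrite -[RHS](addNr (gE k (fun=> 0))) -mulN1r -gE_linear; try exact: gpoly_cst.
by congr gE; apply/funext => g; rewrite mulr0 addr0.
Qed.

Lemma gEZ k (a : R) f : gpoly f -> gE k (fun g => a * f g) = a * gE k f.
Proof.
move=> gf; rewrite -[RHS]addr0 -(gE_cst0 k) -gE_linear//; last exact: gpoly_cst.
by congr gE; apply/funext => g; rewrite addr0.
Qed.

Lemma gED k f h : gpoly f -> gpoly h ->
  gE k (fun g => f g + h g) = gE k f + gE k h.
Proof.
move=> gf gh; rewrite -[gE k f]mul1r -gE_linear//.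
by congr gE; apply/funext => g; rewrite mul1r.
Qed.

Lemma gE_sum k (I : Type) (r : seq I) (F : I -> (nat -> R) -> R) :
  (forall b, gpoly (F b)) ->
  gE k (fun g => \sum_(b <- r) F b g) = \sum_(b <- r) gE k (F b).
Proof.
move=> gF; elim: r => [|b r IH].
  by rewrite big_nil -[RHS](gE_cst0 k); congr gE; apply/funext => g; rewrite big_nil.
rewrite big_cons -IH -gED//; last exact: gpoly_sum.
by congr gE; apply/funext => g; rewrite big_cons.
Qed.

Lemma gE_slice_poly k f f' : pderiv k f f' ->
  exists Q : {poly R}, (forall x, gE k (fun g => f (upd g k x)) = Q.[x]) /\
    (forall x, gE k (fun g => f' (upd g k x)) = Q^`().[x]).
Proof. by apply: gE_linear_at_slice; exact: gE_linear. Qed.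

Lemma gauss_expectE k f : gpoly f ->
  gauss_expect k (fun g => (f g)%:E) = (gE k f)%:E.
Proof.
elim: k f => [//|k IH] f gf /=.
under eq_integral do rewrite (IH _ (gpoly_upd _ _ gf)).
have [f' df] := gpoly_pderiv k gf; have [P [fP _]] := gE_slice_poly df.
under eq_integral do rewrite fP.
by rewrite !gintE.
Qed.

(** The inner expectation is a nonnegative polynomial in the last coordinate with zero integral,
    hence zero by [gint_eq0], and every slice falls under the induction hypothesis. Points vanish
    from [k] on because [gE k] evaluates there. *)
Lemma gE_eq0 k f : gpoly f -> (forall g, 0 <= f g) -> gE k f = 0 ->
  forall g, (forall i, (k <= i)%N -> g i = 0) -> f g = 0.
Proof.
elim: k f => [|k IH] f gf f0 /=.
  by move=> f00 g g0; rewrite -f00; congr f; apply/funext => i; exact: g0.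
have [f' df] := gpoly_pderiv k gf; have [P [fP _]] := gE_slice_poly df.
under eq_integral do rewrite fP.
rewrite gintE /= => /gint_eq0 P0 g gk.
have {}P0 : P = 0 by apply: P0 => x; rewrite -fP; apply: gE_ge0.
(* The induction hypothesis wants a point that vanishes from [k] on: coordinate [k] is reset to 0,
   and the slice puts [g k] back. *)
have gE' : g = upd (upd g k 0) k (g k).
  by apply/funext => i; rewrite /upd; case: eqVneq => [->|].
rewrite gE'; apply: (IH (fun g' => f (upd g' k (g k)))) => //.
- exact: gpoly_upd.
- by rewrite fP P0 horner0.
- move=> i ki; rewrite /upd; case: eqVneq => // ik; apply: gk.
  by rewrite ltn_neqAle eq_sym ik.
Qed.

(** For the outermost coordinate this is [gint_deriv] on the averaged slice; lower coordinates are
    handled under the outer integral by induction. *)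
Lemma gE_stein k i f f' : (i < k)%N -> pderiv i f f' ->
  gE k (fun g => g i * f g) = gE k f'.
Proof.
elim: k f f' => [//|k IH] f f' + df /=; rewrite ltnS leq_eqVlt => /predU1P[ik|ik].
  rewrite {}ik in df *; have [Q [fQ f'Q]] := gE_slice_poly df.
  have gf := pderiv_gpoly df.
  transitivity (gint ('X * Q)); last first.
    by rewrite -gint_deriv /gint; congr fine; apply: eq_integral => x _; rewrite f'Q.
  rewrite /gint; congr fine; apply: eq_integral => x _; congr EFin.
  rewrite hornerM hornerX -fQ -gEZ; last exact: gpoly_upd.
  by congr gE; apply/funext => g; rewrite {1}/upd eqxx.
congr fine; apply: eq_integral => x _; congr EFin.
rewrite -(IH _ _ ik (pderiv_upd _ _ df)) ?ltn_eqF//.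
by congr gE; apply/funext => g; rewrite {1}/upd ltn_eqF.
Qed.


Lemma gE_cst k c : gE k (fun=> c) = c.
Proof.
suff g1 : gE k (fun=> 1) = 1.
  rewrite -[RHS]mulr1 -g1 -gEZ; last exact: gpoly_cst.
  by congr gE; apply/funext => g; rewrite mulr1.
elim: k => //= k ->; rewrite -[RHS](gint1 R) /gint; congr fine.
by apply: eq_integral => x _; rewrite hornerC.
Qed.

Lemma gE_wick2 k a b : (a < k)%N ->
  gE k (fun g => g a * g b) = (b == a)%:R.
Proof. by move=> ak; rewrite (gE_stein ak (pderiv_var a b)) gE_cst. Qed.

(** The Isserlis formula of order four: integration by parts in the first factor pairs it with each
    of the other three. *)
Lemma gE_wick4 k a b c e : (a < k)%N -> (b < k)%N -> (c < k)%N ->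
  gE k (fun g => g a * (g b * (g c * g e))) =
  (b == a)%:R * (e == c)%:R + (c == a)%:R * (e == b)%:R + (e == a)%:R * (c == b)%:R.
Proof.
move=> ak bk ck.
have := pderivM (pderiv_var a b) (pderivM (pderiv_var a c) (pderiv_var a e)).
move/(gE_stein ak) ->.
have g2 x y : gpoly (fun g => g x * g y) by apply: gpolyM; exact: gpoly_var.
have gv x := gpoly_var x.
rewrite gED; [|by apply: gpolyZ|apply: gpolyM => //; apply: gpolyD;
  apply: gpolyM => //; exact: gpoly_cst].
rewrite gEZ// gE_wick2// -addrA; congr (_ + _).
rewrite -[X in X * (e == b)%:R]mulr1.
transitivity (gE k (fun g => (c == a)%:R * (g b * g e) + (e == a)%:R * (g b * g c))).
  by congr gE; apply/funext => g; ring.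
rewrite gED; try by apply: gpolyZ.
by rewrite !gEZ// !gE_wick2// mulr1.
Qed.

End gpoly.

(** * Linear self-attention on Gaussian data *)

Lemma sum_delta (R : pzRingType) d (i : 'I_d) (F : 'I_d -> R) :
  \sum_b (b == i)%:R * F b = F i.
Proof.
rewrite (bigD1 i)//= eqxx mul1r big1 ?addr0// => b /negbTE ->.
by rewrite mul0r.
Qed.

(** * Entries of the prediction in block coordinates *)

Section prediction_entries.
Variables (R : realType) (d n : nat).
Implicit Types (X : 'M[R]_(d, n)) (w : 'cV[R]_d) (V W : 'M[R]_(de d)).

Definition rowX (i : 'I_d) : 'I_(de d) := lshift (d + 1) (lshift 1 i).
Definition rowy : 'I_(de d) := lshift (d + 1) (rshift d ord0).
Definition roww (i : 'I_d) : 'I_(de d) := rshift (d + 1) (lshift 1 i).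
Definition row1 : 'I_(de d) := rshift (d + 1) (rshift d ord0).

Lemma de_cases (P : 'I_(de d) -> Prop) :
  (forall i, P (rowX i)) -> P rowy -> (forall i, P (roww i)) -> P row1 ->
  forall r, P r.
Proof.
move=> PX Py Pw P1 r; case: (split_ordP r) => s -> {r}; case: (split_ordP s) => t -> {s}.
- exact: PX.
- by rewrite (ord1 t); exact: Py.
- exact: Pw.
- by rewrite (ord1 t); exact: P1.
Qed.

Lemma row1_eqE : (forall i, (rowX i == row1) = false) * ((rowy == row1) = false) *
  (forall i, (roww i == row1) = false) * ((row1 == row1) = true).
Proof.
by do !split=> *; rewrite ?eqxx// /rowX /rowy /roww /row1 ?eq_lrshift// eq_rshift eq_lrshift.
Qed.

Lemma sum_de (F : 'I_(de d) -> R) :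
  \sum_a F a = (\sum_i F (rowX i) + F rowy) + (\sum_i F (roww i) + F row1).
Proof. by rewrite big_split_ord /= !big_split_ord /= !big_ord1. Qed.

Lemma Z0_entries X w :
  (forall i c, Z0 X w (rowX i) (lshift 1 c) = X i c) *
  (forall c, Z0 X w rowy (lshift 1 c) = \sum_j w j 0 * X j c) *
  (forall i c, Z0 X w (roww i) c = 0) *
  (forall c, Z0 X w row1 (lshift 1 c) = 0) *
  (forall i, Z0 X w (rowX i) (rshift n ord0) = 0) *
  (Z0 X w rowy (rshift n ord0) = 0) *
  (Z0 X w row1 (rshift n ord0) = 1).
Proof.
rewrite /Z0; do !split=> *.
- by rewrite col_mxEu col_mxEu row_mxEl.
- rewrite col_mxEu col_mxEd row_mxEl /labels mxE.
  by apply: eq_bigr => j _; rewrite mxE.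
- by rewrite col_mxEd col_mxEu row_mx0 mxE.
- by rewrite col_mxEd col_mxEd row_mxEl mxE.
- by rewrite col_mxEu col_mxEu row_mxEr mxE.
- by rewrite col_mxEu col_mxEd row_mxEr mxE.
- by rewrite col_mxEd col_mxEd row_mxEr mxE.
Qed.

Definition gram X (i j : 'I_d) : R := \sum_c X i c * X j c.

(* The last column of [Z0] is a unit vector, so only the last column of [W] matters. *)
Lemma predictionE V W X w r :
  let h i := \sum_j gram X i j * (W (rowX j) row1 + W rowy row1 * w j 0) in
  prediction V W X w r 0 = (r == row1)%:R + n%:R^-1 *
    (\sum_i V r (rowX i) * h i + V r rowy * (\sum_i w i 0 * h i)
     + V r row1 * W row1 row1).
Proof.
move=> h; set Z := Z0 X w; set l := rshift n (ord0 : 'I_1).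
have Zl a : Z a l = (a == row1)%:R.
  by elim/de_cases: a => [i||i|]; rewrite /Z Z0_entries row1_eqE.
have WZ b : (W *m Z) b l = W b row1.
  by rewrite mxE; under eq_bigr do rewrite Zl mulrC; rewrite sum_delta.
(* [m c] is the attention score of token [c] against the last column. The weight rows of [Z] are
   zero and contribute nothing; summing [m] against a row of [X] produces the Gram matrix. *)
pose m c := \sum_j X j c * (W (rowX j) row1 + W rowy row1 * w j 0).
have ZWZ c : (Z^T *m (W *m Z)) (lshift 1 c) l = m c.
  rewrite mxE; under eq_bigr do rewrite mxE WZ.
  rewrite sum_de /Z !Z0_entries mul0r addr0 [X in _ + X]big1 ?addr0; last first.
    by move=> i _; rewrite Z0_entries mul0r.
  rewrite mulr_suml -big_split /=; apply: eq_bigr => j _.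
  by rewrite Z0_entries; ring.
have ZWZl : (Z^T *m (W *m Z)) l l = W row1 row1.
  rewrite mxE; under eq_bigr do rewrite mxE WZ Zl.
  by rewrite sum_delta.
have mh i : \sum_c X i c * m c = h i.
  rewrite /h /gram; under eq_bigr do rewrite mulr_sumr.
  rewrite exchange_big /=; apply: eq_bigr => j _.
  by rewrite mulr_suml; apply: eq_bigr => c _; ring.
have ZZ a : (Z *m (Z^T *m (W *m Z))) a l =
    \sum_c Z a (lshift 1 c) * m c + (a == row1)%:R * W row1 row1.
  rewrite mxE big_split_ord /= big_ord1 ZWZl Zl; congr (_ + _).
  by apply: eq_bigr => c _; rewrite ZWZ.
rewrite /prediction mxE /fLSA mxE Zl; congr (_ + _); rewrite mxE; congr (_ * _).
have ZZX i : (Z *m (Z^T *m (W *m Z))) (rowX i) l = h i.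
  rewrite ZZ row1_eqE mul0r addr0 -mh.
  by apply: eq_bigr => c _; rewrite /Z Z0_entries.
have ZZy : (Z *m (Z^T *m (W *m Z))) rowy l = \sum_i w i 0 * h i.
  rewrite ZZ row1_eqE mul0r addr0.
  under eq_bigr do rewrite /Z Z0_entries mulr_suml.
  rewrite exchange_big /=; apply: eq_bigr => i _; rewrite -mh mulr_sumr.
  by apply: eq_bigr => c _; rewrite mulrA.
have ZZw i : (Z *m (Z^T *m (W *m Z))) (roww i) l = 0.
  rewrite ZZ row1_eqE mul0r addr0 big1// => c _.
  by rewrite /Z Z0_entries mul0r.
have ZZ1 : (Z *m (Z^T *m (W *m Z))) row1 l = W row1 row1.
  rewrite ZZ row1_eqE mul1r big1 ?add0r// => c _.
  by rewrite /Z Z0_entries mul0r.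
rewrite -!mulmxA mxE -/Z -/l sum_de ZZy ZZ1; under eq_bigr do rewrite ZZX.
rewrite [X in _ + (X + _)]big1 ?add0r// => i _.
by rewrite ZZw mulr0.
Qed.

End prediction_entries.

(** * Gaussian moments of the Gram matrix and of the weights *)

Section moments.
Variables (R : realType) (d n : nat).
Implicit Types (g : nat -> R) (f F : (nat -> R) -> R).
Notation k := (d * n + d)%N.

(** Same layout of the Gaussian coordinates as in [X_of] and [w_of]: the data row by row, then the
    weights. *)
Definition iX (i : 'I_d) (c : 'I_n) : nat := (i * n + c)%N.
Definition iw (i : 'I_d) : nat := (d * n + i)%N.

Lemma iX_ltw i c j : (iX i c < iw j)%N.
Proof.
have := leq_mul2r n i.+1 d; rewrite ltn_ord orbT mulSn => H.
by have := ltn_ord c; rewrite /iX /iw; lia.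
Qed.

Lemma iw_lt i : (iw i < k)%N. Proof. by rewrite ltn_add2l. Qed.

Lemma iX_lt i c : (iX i c < k)%N.
Proof. exact: ltn_trans (iX_ltw i c i) (iw_lt i). Qed.

Lemma eq_iw i j : (iw i == iw j) = (i == j).
Proof. by rewrite eqn_add2l. Qed.

(** Euclidean division by [n] recovers the row and the column. *)
Lemma eq_iX i c j e : (iX i c == iX j e) = (i == j) && (c == e).
Proof.
apply/eqP/andP => [H|[/eqP-> /eqP->]//].
have n0 : (0 < n)%N by exact: leq_ltn_trans (ltn_ord c).
have := congr1 (divn^~ n) H; have := congr1 (modn^~ n) H.
rewrite /iX !modnMDl !modn_small// !divnMDl// !divn_small// !addn0.
by split; exact/eqP/val_inj.
Qed.

(** Vanishing weight derivatives replace independence of the weights: this is what integration by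
    parts in a weight needs. *)
Definition wfree F := gpoly F /\ forall l, pderiv (iw l) F (fun=> 0).

Lemma wfreeX i c : wfree (fun g => g (iX i c)).
Proof.
split=> [|l]; first exact: gpoly_var.
by apply: pderiv_ext (pderiv_var _ _ _) _ => g; rewrite ltn_eqF ?iX_ltw.
Qed.

Lemma wfreeM F F' : wfree F -> wfree F' -> wfree (fun g => F g * F' g).
Proof.
move=> [gF dF] [gF' dF']; split=> [|l]; first exact: gpolyM.
by apply: pderiv_ext (pderivM (dF l) (dF' l)) _ => g; rewrite mulr0 mul0r addr0.
Qed.

Lemma wfree_sum (I : Type) (r : seq I) (F : I -> (nat -> R) -> R) :
  (forall a, wfree (F a)) -> wfree (fun g => \sum_(a <- r) F a g).
Proof.
move=> wF; split=> [|l]; first by apply: gpoly_sum => a; case: (wF a).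
apply: pderiv_ext (pderiv_sum _ (fun a => (wF a).2 l)) _ => g.
by rewrite big1.
Qed.

(** Integration by parts in [iw a] leaves the derivative of [F], which is 0. *)
Lemma gE_w1 a F : wfree F -> gE k (fun g => g (iw a) * F g) = 0.
Proof. by move=> [_ dF]; rewrite (gE_stein (iw_lt a) (dF a)) gE_cst. Qed.

Lemma gE_w2 a b F : wfree F ->
  gE k (fun g => g (iw a) * (g (iw b) * F g)) = (b == a)%:R * gE k F.
Proof.
move=> [gF dF]; rewrite (gE_stein (iw_lt a) (pderivM (pderiv_var _ _ _) (dF a))) -gEZ//.
by congr gE; apply/funext => g; rewrite eq_iw mulr0 addr0.
Qed.

(** One integration by parts lowers the degree in the weights from three to one, which is
    [gE_w1]. *)
Lemma gE_w3 a b c F : wfree F ->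
  gE k (fun g => g (iw a) * (g (iw b) * (g (iw c) * F g))) = 0.
Proof.
move=> wF; have [gF dF] := wF.
rewrite (gE_stein (iw_lt a) (pderivM (pderiv_var _ _ _) (pderivM (pderiv_var _ _ _) (dF a)))).
transitivity (gE k (fun g => (iw b == iw a)%:R * (g (iw c) * F g) +
    (iw c == iw a)%:R * (g (iw b) * F g))).
  by congr gE; apply/funext => g; ring.
have gw e : gpoly (fun g => g (iw e) * F g) by apply: gpolyM => //; exact: gpoly_var.
rewrite gED; try exact: gpolyZ.
by rewrite !gEZ// !gE_w1// !mulr0 addr0.
Qed.

Definition sgram i j g : R := gram (X_of d n g) i j.

Lemma sgramE i j g : sgram i j g = \sum_c g (iX i c) * g (iX j c).
Proof. by apply: eq_bigr => c _; rewrite !mxE. Qed.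

Lemma sgram_sym i j g : sgram i j g = sgram j i g.
Proof. by apply: eq_bigr => c _; rewrite mulrC. Qed.

Lemma wfreeG i j : wfree (sgram i j).
Proof.
rewrite (_ : sgram i j = fun g => \sum_c g (iX i c) * g (iX j c)); last first.
  by apply/funext => g; rewrite sgramE.
by apply: wfree_sum => c; apply: wfreeM; exact: wfreeX.
Qed.

Lemma gE_G i j : gE k (sgram i j) = n%:R * (i == j)%:R.
Proof.
rewrite (_ : sgram i j = fun g => \sum_c g (iX i c) * g (iX j c)); last first.
  by apply/funext => g; rewrite sgramE.
rewrite gE_sum; last by move=> c; apply: gpolyM; exact: gpoly_var.
under eq_bigr do rewrite gE_wick2 ?iX_lt// eq_iX eqxx andbT eq_sym.
by rewrite sumr_const card_ord mulr_natl.
Qed.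

(** Of the three Wick pairings, the one within each Gram entry leaves both columns free and gives
    [n] squared; the other two force equal columns and give [n * d] and [n]. *)
Lemma gE_GG i j : \sum_b gE k (fun g => sgram i b g * sgram j b g) =
  n%:R * (n + d + 1)%:R * (i == j)%:R.
Proof.
have E b : gE k (fun g => sgram i b g * sgram j b g) =
   \sum_(c < n) \sum_(e < n) ((b == i)%:R * (b == j)%:R + (i == j)%:R * (e == c)%:R
     + (e == c)%:R * ((b == i)%:R * (b == j)%:R)).
  rewrite (_ : (fun g => _) = fun g => \sum_c \sum_e
    g (iX i c) * (g (iX b c) * (g (iX j e) * g (iX b e)))); last first.
    apply/funext => g; rewrite !sgramE mulr_suml; apply: eq_bigr => c _.
    by rewrite mulr_sumr; apply: eq_bigr => e _; ring.
  have gv x : gpoly (fun g : nat -> R => g x) by exact: gpoly_var.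
  have g4 c e : gpoly (fun g => g (iX i c) * (g (iX b c) * (g (iX j e) * g (iX b e)))).
    by do !apply: gpolyM.
  rewrite gE_sum; last by move=> c; apply: gpoly_sum.
  apply: eq_bigr => c _; rewrite gE_sum//; apply: eq_bigr => e _.
  rewrite gE_wick4 ?iX_lt// !eq_iX !eqxx !andbT /= (eq_sym j i) (eq_sym j b).
  by do 4 case: eqP => _; rewrite /=; ring.
pose A b : R := (b == i)%:R * (b == j)%:R.
transitivity (\sum_b n%:R * (n%:R * A b + (i == j)%:R + A b)).
  apply: eq_bigr => b _.
  rewrite E (eq_bigr (fun=> n%:R * A b + (i == j)%:R + A b)); last first.
    move=> c _; rewrite !big_split /= sumr_const card_ord -/(A b) mulr_natl.
    congr (_ + _ + _); last by rewrite sum_delta.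
    by under eq_bigr do rewrite mulrC; rewrite sum_delta.
  by rewrite sumr_const card_ord -[LHS]mulr_natl.
rewrite -mulr_sumr !big_split /= -mulr_sumr sum_delta sumr_const card_ord -mulr_natl.
by rewrite !natrD; ring.
Qed.

End moments.

(** * Orthogonality of the gradient-step residual to the span of predictions *)

Section orthogonality.
Variables (R : realType) (d n : nat).
Implicit Types (g : nat -> R) (f F : (nat -> R) -> R).
Notation k := (d * n + d)%N.
Notation kappa := ((n + d + 1)%:R^-1 : R).
Notation iw := (@iw d n).
Notation sgram := (@sgram R d n).
Notation wfree := (@wfree R d n).

Definition sgramw (i : 'I_d) g : R := \sum_j sgram i j g * g (iw j).

(** [kappa] is the learning rate n / (n + d + 1) divided by n, and [sgramw i] is coordinate [i] of G
    w. *)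
Definition step_error i g : R := kappa * sgramw i g - g (iw i).

Let gw a : gpoly (fun g : nat -> R => g (iw a)). Proof. exact: gpoly_var. Qed.
Let gG i j : gpoly (sgram i j). Proof. by case: (@wfreeG R d n i j). Qed.

Lemma gpolyT i : gpoly (sgramw i).
Proof. by apply: gpoly_sum => j; exact: gpolyM. Qed.

Lemma gpoly_step_error i : gpoly (step_error i).
Proof. by apply: gpolyB => //; apply: gpolyZ; exact: gpolyT. Qed.

(** Brings one weight to the front of each term, the form in which [gE_w1], [gE_w2] and [gE_w3]
    apply. *)
Lemma gE_step_errorM i f : gpoly f -> gE k (fun g => step_error i g * f g) =
  kappa * (\sum_j gE k (fun g => g (iw j) * (sgram i j g * f g)))
  - gE k (fun g => g (iw i) * f g).
Proof.
move=> gf.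
have gj j : gpoly (fun g => g (iw j) * (sgram i j g * f g)).
  by apply: gpolyM => //; exact: gpolyM.
rewrite -gE_sum// -mulN1r -gEZ; last exact: gpoly_sum.
rewrite -gEZ; last exact: gpolyM.
rewrite -gED; [|by apply: gpolyZ; exact: gpoly_sum|by apply: gpolyZ; exact: gpolyM].
congr gE; apply/funext => g; rewrite /step_error /sgramw mulrBl mulN1r mulr_sumr mulr_suml.
rewrite mulr_sumr; congr (_ - _).
by apply: eq_bigr => j _; ring.
Qed.

(** Polynomiality is bundled in because the linearity of [gE] requires it. *)
Definition orth i f := gpoly f /\ gE k (fun g => step_error i g * f g) = 0.

Lemma orthD i f h : orth i f -> orth i h -> orth i (fun g => f g + h g).
Proof.
move=> [gf f0] [gh h0]; split; first exact: gpolyD.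
rewrite -[RHS]addr0 -[X in X + _]f0 -h0 -gED; try by apply: gpolyM => //; exact: gpoly_step_error.
by congr gE; apply/funext => g; rewrite mulrDr.
Qed.

Lemma orthZ i a f : orth i f -> orth i (fun g => a * f g).
Proof.
move=> [gf f0]; split; first exact: gpolyZ.
rewrite -[RHS](mulr0 a) -f0 -gEZ; last by apply: gpolyM => //; exact: gpoly_step_error.
by congr gE; apply/funext => g; rewrite mulrCA.
Qed.

Lemma orth_sum i (I : Type) (r : seq I) (F : I -> (nat -> R) -> R) :
  (forall a, orth i (F a)) -> orth i (fun g => \sum_(a <- r) F a g).
Proof.
move=> oF; elim: r => [|a r IH].
  rewrite (_ : (fun g => _) = fun g => 0).
    split; first exact: gpoly_cst.
    by rewrite -[RHS](gE_cst k 0); congr gE; apply/funext => g; rewrite mulr0.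
  by apply/funext => g; rewrite big_nil.
rewrite (_ : (fun g => _) = fun g => F a g + \sum_(a <- r) F a g).
  exact: orthD.
by apply/funext => g; rewrite big_cons.
Qed.

(** The residual is linear in the weights, so only first moments of weights occur. *)
Lemma orth_wfree i F : wfree F -> orth i F.
Proof.
move=> wF; split; first by case: wF.
rewrite gE_step_errorM; last by case: wF.
rewrite gE_w1// big1 ?mulr0 ?subr0// => j _.
by apply: gE_w1; apply: wfreeM => //; exact: wfreeG.
Qed.

(** The product with the residual is cubic in the weights, hence has mean zero. *)
Lemma orth_w2 i a b F : wfree F -> orth i (fun g => g (iw a) * (g (iw b) * F g)).
Proof.
move=> wF; have gF : gpoly F by case: wF.
have g2 : gpoly (fun g => g (iw a) * (g (iw b) * F g)).
  by apply: gpolyM => //; exact: gpolyM.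
split=> //; rewrite gE_step_errorM// gE_w3// big1 ?mulr0 ?subr0// => j _.
rewrite -[RHS](@gE_w3 R d n j a b (fun g => sgram i j g * F g)); last first.
  by apply: wfreeM => //; exact: wfreeG.
by congr gE; apply/funext => g; ring.
Qed.

(** This fixes the learning rate: the expectation is [kappa] times an entry of E G^2 minus the same
    entry of E G, and [kappa * (n + d + 1)] is 1. *)
Lemma orthT i a : orth i (sgramw a).
Proof.
split; first exact: gpolyT.
rewrite gE_step_errorM; last exact: gpolyT.
have gGG b : gpoly (fun g => sgram i b g * sgram a b g) by exact: gpolyM.
have -> : \sum_j gE k (fun g => g (iw j) * (sgram i j g * sgramw a g)) =
    n%:R * (n + d + 1)%:R * (i == a)%:R.
  rewrite -gE_GG; apply: eq_bigr => j _.
  rewrite (_ : (fun g => _) =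
      fun g => \sum_b g (iw j) * (g (iw b) * (sgram i j g * sgram a b g))).
    rewrite gE_sum; last by move=> b; do !apply: gpolyM.
    rewrite -[RHS](sum_delta j (fun b => gE k (fun g => sgram i j g * sgram a b g))).
    by apply: eq_bigr => b _; apply: gE_w2; apply: wfreeM; exact: wfreeG.
  by apply/funext => g; rewrite !mulr_sumr; apply: eq_bigr => b _; ring.
rewrite (_ : (fun g => _) = fun g => \sum_b g (iw i) * (g (iw b) * sgram a b g)).
  rewrite gE_sum; last by move=> b; do !apply: gpolyM.
  rewrite (eq_bigr (fun b => (b == i)%:R * gE k (sgram a b))); last first.
    by move=> b _; apply: gE_w2; exact: wfreeG.
  rewrite sum_delta gE_G eq_sym; field.
  by rewrite -natrD natr1 pnatr_eq0.
by apply/funext => g; rewrite !mulr_sumr; apply: eq_bigr => b _; ring.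
Qed.

End orthogonality.

(** * Optimality of the gradient step *)

Section optimum.
Variables (R : realType) (d n : nat).
Implicit Types (g : nat -> R) (X : 'M[R]_(d, n)) (w : 'cV[R]_d) (V W : 'M[R]_(de d)).
Notation k := (d * n + d)%N.
Notation kappa := ((n + d + 1)%:R^-1 : R).
Notation iw := (@iw d n).
Notation sgram := (@sgram R d n).
Notation sgramw := (@sgramw R d n).
Notation orth := (@orth R d n).

Definition gd_step X w : 'cV[R]_(de d) :=
  col_mx (col_mx 0 0) (col_mx (kappa *: (X *m (labels X w)^T)) (const_mx 1)).

Lemma gd_step_entries X w :
  (forall i, gd_step X w (rowX i) 0 = 0) * (gd_step X w (rowy d) 0 = 0) *
  (forall i, gd_step X w (roww i) 0 = kappa * \sum_j gram X i j * w j 0) *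
  (gd_step X w (row1 d) 0 = 1).
Proof.
rewrite /gd_step; do !split=> *.
- by rewrite col_mxEu col_mxEu mxE.
- by rewrite col_mxEu col_mxEd mxE.
- rewrite col_mxEd col_mxEu !mxE; congr (_ * _).
  under eq_bigr do rewrite !mxE mulr_sumr.
  rewrite exchange_big; apply: eq_bigr => j _; rewrite mulr_suml.
  by apply: eq_bigr => c _; rewrite !mxE; ring.
- by rewrite col_mxEd col_mxEd mxE.
Qed.

Lemma target_entries w :
  (forall i, target w (rowX i) 0 = 0) * (target w (rowy d) 0 = 0) *
  (forall i, target w (roww i) 0 = w i 0) * (target w (row1 d) 0 = 1).
Proof.
rewrite /target; do !split=> *.
- by rewrite col_mxEu col_mxEu mxE.
- by rewrite col_mxEu col_mxEd mxE.
- by rewrite col_mxEd col_mxEu.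
- by rewrite col_mxEd col_mxEd mxE.
Qed.

(** [Wopt] pairs the label row with the constant 1 of the last column, so the scores are the labels.
    [Vopt] copies the data rows into the weight slot; its factor [n] cancels the normalization of
    the attention. *)
Definition Vopt : 'M[R]_(de d) :=
  block_mx 0 0 (block_mx (n%:R * kappa)%:M 0 0 0) 0.
Definition Wopt : 'M[R]_(de d) := delta_mx (rowy d) (row1 d).

Lemma prediction_opt X w : (0 < n)%N -> prediction Vopt Wopt X w = gd_step X w.
Proof.
move=> n0; have nn0 : n%:R != 0 :> R by rewrite pnatr_eq0 -lt0n.
have W1 i : Wopt (rowX i) (row1 d) = 0.
  by rewrite mxE /rowX /rowy eq_lshift eq_lrshift.
have W2 : Wopt (rowy d) (row1 d) = 1 by rewrite mxE !eqxx.
have W3 : Wopt (row1 d) (row1 d) = 0 by rewrite mxE /rowy /row1 eq_rlshift.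
apply/colP; elim/de_cases => [i||i|];
  rewrite predictionE W3 W2 mulr0 addr0 row1_eqE gd_step_entries.
- rewrite /Vopt block_mxEul mxE mul0r addr0 big1 ?mulr0 ?addr0// => j _.
  by rewrite block_mxEul mxE mul0r.
- rewrite /Vopt block_mxEul mxE mul0r addr0 big1 ?mulr0 ?addr0// => j _.
  by rewrite block_mxEul mxE mul0r.
- rewrite add0r /Vopt block_mxEdl block_mxEur mxE mul0r addr0 (bigD1 i)//=.
  rewrite [X in _ * (_ + X)]big1 ?addr0; last first.
    by move=> j /negbTE ji; rewrite block_mxEdl block_mxEul mxE eq_sym ji mul0r.
  rewrite block_mxEdl block_mxEul mxE eqxx mulr1n !mulrA mulVf// mul1r; congr (_ * _).
  by apply: eq_bigr => j _; rewrite W1 add0r mul1r.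
- rewrite /Vopt block_mxEdl block_mxEdr mxE mul0r addr0 big1 ?mulr0 ?addr0// => j _.
  by rewrite block_mxEdl block_mxEdl mxE mul0r.
Qed.

(** By [predictionE] the entry is a linear combination of constants, Gram entries, coordinates of G
    w and the quadratic form w^T G w, each of which is orthogonal to the residual. *)
Lemma orth_prediction i V W r :
  orth i (fun g => prediction V W (X_of d n g) (w_of d n g) r 0).
Proof.
pose p j := W (rowX j) (row1 d); pose q := W (rowy d) (row1 d).
have wE g j : w_of d n g j 0 = g (iw j) by rewrite mxE.
rewrite (_ : (fun g => _) = fun g => (r == row1 d)%:R + n%:R^-1 *
  (\sum_a V r (rowX a) * (\sum_j p j * sgram a j g + q * sgramw a g)
   + V r (rowy d) * (\sum_j p j * sgramw j g +
       q * \sum_a \sum_j g (iw a) * (g (iw j) * sgram a j g))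
   + V r (row1 d) * W (row1 d) (row1 d))).
  have oc c : orth i (fun=> c).
    by apply: orth_wfree; split=> [|l]; [exact: gpoly_cst|exact: pderiv_cst].
  apply: orthD => //; apply: orthZ; do ![apply: orthD => //].
  - apply: orth_sum => a; apply: orthZ; apply: orthD; last by apply: orthZ; exact: orthT.
    by apply: orth_sum => j; apply: orthZ; apply: orth_wfree; exact: wfreeG.
  - apply: orthZ; apply: orthD.
      by apply: orth_sum => j; apply: orthZ; exact: orthT.
    apply: orthZ; apply: orth_sum => a; apply: orth_sum => j.
    by apply: orth_w2; exact: wfreeG.
apply/funext => g; rewrite predictionE; congr (_ + _ * (_ + _ * _ + _)).
  apply: eq_bigr => a _; congr (_ * _); rewrite mulr_sumr -big_split /=.
  by apply: eq_bigr => j _; rewrite wE -/(sgram a j g) /p /q; ring.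
under eq_bigr do rewrite mulr_sumr.
(* Symmetry of the Gram matrix turns the terms linear in the weights into coordinates of G w. *)
transitivity (\sum_a \sum_j (p j * (sgram j a g * g (iw a)) +
    q * (g (iw a) * (g (iw j) * sgram a j g)))).
  apply: eq_bigr => a _; apply: eq_bigr => j _.
  by rewrite !wE -/(sgram a j g) (sgram_sym n a j) /p /q; ring.
under eq_bigr do rewrite big_split /= -mulr_sumr.
rewrite big_split /= -mulr_sumr; congr (_ + _).
by rewrite exchange_big /=; apply: eq_bigr => j _; rewrite mulr_sumr.
Qed.

Lemma gd_stepT i g : gd_step (X_of d n g) (w_of d n g) (roww i) 0 = kappa * sgramw i g.
Proof.
rewrite gd_step_entries; congr (_ * _).
by apply: eq_bigr => j _; rewrite mxE.
Qed.

Notation residual V W r := (fun g =>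
  prediction V W (X_of d n g) (w_of d n g) r 0 - target (w_of d n g) r 0).
Notation excess V W r := (fun g =>
  prediction V W (X_of d n g) (w_of d n g) r 0 -
  gd_step (X_of d n g) (w_of d n g) r 0).
Notation gd_residual r := (fun g =>
  gd_step (X_of d n g) (w_of d n g) r 0 - target (w_of d n g) r 0).

(** Polynomiality is the first component of [orth] at any coordinate; [0 < d] supplies one. *)
Lemma gpoly_prediction V W r : (0 < d)%N ->
  gpoly (fun g => prediction V W (X_of d n g) (w_of d n g) r 0).
Proof. by move=> d0; have [] := orth_prediction (Ordinal d0) V W r. Qed.

Lemma gpoly_gd_step r : (0 < d)%N -> (0 < n)%N ->
  gpoly (fun g => gd_step (X_of d n g) (w_of d n g) r 0).
Proof.
move=> d0 n0; apply: gpoly_ext (gpoly_prediction Vopt Wopt r d0) _ => g.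
by rewrite prediction_opt.
Qed.

Lemma gpoly_target r : gpoly (fun g => target (w_of d n g) r 0).
Proof.
elim/de_cases: r => [i||i|].
- by apply: gpoly_ext (gpoly_cst 0) _ => g; rewrite target_entries.
- by apply: gpoly_ext (gpoly_cst 0) _ => g; rewrite target_entries.
- by apply: gpoly_ext (gpoly_var _ (iw i)) _ => g; rewrite target_entries mxE.
- by apply: gpoly_ext (gpoly_cst 1) _ => g; rewrite target_entries.
Qed.

Lemma LEvalE V W : (0 < d)%N -> LEval n V W =
  (2^-1 * \sum_r gE k (fun g => residual V W r g ^+ 2))%:E.
Proof.
move=> d0.
have gr r : gpoly (fun g => residual V W r g ^+ 2).
  have gr : gpoly (residual V W r).
    by apply: gpolyB; [exact: gpoly_prediction|exact: gpoly_target].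
  by apply: gpoly_ext (gpolyM gr gr) _ => g; rewrite expr2.
have E : (fun g => 2%:R^-1 * sqnorm
    (prediction V W (X_of d n g) (w_of d n g) - target (w_of d n g)))
   = (fun g => 2^-1 * \sum_r residual V W r g ^+ 2).
  apply/funext => g; congr (_ * _); apply: eq_bigr => r _.
  by rewrite mxE [in X in _ + X]mxE.
rewrite /LEval (gauss_expectE k (f := fun g => _)) E.
  by rewrite gEZ ?gE_sum//; exact: gpoly_sum.
by apply: gpolyZ; exact: gpoly_sum.
Qed.

(** The cross term vanishes: off the weight rows [gd_residual] is 0, and on weight row [i] it is
    [step_error i], orthogonal to the prediction and to the gradient step. *)
Lemma pythagoras V W r : (0 < d)%N -> (0 < n)%N ->
  gE k (fun g => residual V W r g ^+ 2) =
  gE k (fun g => excess V W r g ^+ 2) + gE k (fun g => gd_residual r g ^+ 2).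
Proof.
move=> d0 n0.
have ge : gpoly (excess V W r).
  by apply: gpolyB; [exact: gpoly_prediction|exact: gpoly_gd_step].
have gg : gpoly (gd_residual r).
  by apply: gpolyB; [exact: gpoly_gd_step|exact: gpoly_target].
have cross : gE k (fun g => gd_residual r g * excess V W r g) = 0.
  elim/de_cases: r ge gg => [i||i|] ge gg.
  - rewrite -[RHS](gE_cst k 0); congr gE; apply/funext => g.
    by rewrite gd_step_entries target_entries subrr mul0r.
  - rewrite -[RHS](gE_cst k 0); congr gE; apply/funext => g.
    by rewrite gd_step_entries target_entries subrr mul0r.
  - have [_ <-] : orth i (fun g => prediction V W (X_of d n g) (w_of d n g) (roww i) 0
         + (- kappa) * sgramw i g).
      by apply: orthD; [exact: orth_prediction|apply: orthZ; exact: orthT].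
    congr gE; apply/funext => g; rewrite gd_stepT target_entries mxE mulNr.
    by [].
  - rewrite -[RHS](gE_cst k 0); congr gE; apply/funext => g.
    by rewrite gd_step_entries target_entries subrr mul0r.
have sq f : gpoly f -> gpoly (fun g => f g ^+ 2 : R).
  by move=> gf; apply: gpoly_ext (gpolyM gf gf) _ => g; rewrite expr2.
transitivity (gE k (fun g => (excess V W r g ^+ 2 + gd_residual r g ^+ 2)
     + 2 * (gd_residual r g * excess V W r g))).
  by congr gE; apply/funext => g; ring.
rewrite gED; [|by apply: gpolyD; exact: sq|by apply: gpolyZ; exact: gpolyM].
rewrite gED; [|exact: sq|exact: sq].
by rewrite gEZ ?cross ?mulr0 ?addr0//; exact: gpolyM.
Qed.

(** Carries a statement on Gaussian coordinates to arbitrary data and weights; vanishing from [k] on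
    is the side condition of [gE_eq0]. *)
Lemma exists_sample X w : exists g,
  [/\ X_of d n g = X, w_of d n g = w & forall i, (k <= i)%N -> g i = 0].
Proof.
pose g m : R := \sum_i \sum_c (m == iX i c)%:R * X i c + \sum_i (m == iw i)%:R * w i 0.
exists g; split.
- apply/matrixP => i c; rewrite mxE /g -/(iX i c).
  rewrite [X in _ + X]big1 ?addr0; last by move=> j _; rewrite ltn_eqF ?mul0r// iX_ltw.
  rewrite (eq_bigr (fun j => (j == i)%:R * X j c)) ?sum_delta// => j _.
  rewrite -(sum_delta c (fun e => (j == i)%:R * X j e)); apply: eq_bigr => e _.
  by rewrite eq_iX (eq_sym i) (eq_sym c) mulrA -natrM mulnb andbC.
- apply/colP => i; rewrite mxE /g -/(iw i).
  rewrite big1 ?add0r; last first.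
    by move=> j _; rewrite big1// => c _; rewrite gtn_eqF ?mul0r// iX_ltw.
  rewrite -[RHS](sum_delta i (fun j => w j 0)); apply: eq_bigr => j _.
  by rewrite eq_iw eq_sym.
- move=> m km; rewrite /g big1 ?add0r; last first.
    by move=> i _; rewrite big1// => c _; rewrite gtn_eqF ?mul0r// (leq_trans (iX_lt _ _)).
  rewrite big1// => i _.
  by rewrite gtn_eqF ?mul0r// (leq_trans (iw_lt _ _)).
Qed.

End optimum.

Theorem theorem3p1 (R : realType) (d n : nat) (hd : (1 <= d)%N) (hn : (1 <= n)%N)
  (Vs Ws : 'M[R]_(de d))
  (hmin : forall V W : 'M[R]_(de d), (LEval n Vs Ws <= LEval n V W)%E) :
  let eta := n%:R / (n + d + 1)%:R : R in
  forall (X : 'M[R]_(d, n)) (wstar : 'cV[R]_d),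
    prediction Vs Ws X wstar =
    col_mx (col_mx 0 0)
      (col_mx ((eta / n%:R) *: (X *m (labels X wstar)^T)) (const_mx 1)).
Proof.
move=> eta X wstar.
have nn0 : n%:R != 0 :> R by rewrite pnatr_eq0 -lt0n.
have -> : eta / n%:R = (n + d + 1)%:R^-1 by rewrite /eta mulrAC divff// mul1r.
have gg V W r : gpoly (fun g => prediction V W (X_of d n g) (w_of d n g) r 0 -
    gd_step (X_of d n g) (w_of d n g) r 0 : R).
  by apply: gpolyB; [exact: gpoly_prediction|exact: gpoly_gd_step].
have := hmin (Vopt R d n) (Wopt R d).
rewrite !LEvalE// lee_fin ler_pM2l ?invr_gt0//.
under eq_bigr do rewrite pythagoras//.
under [leRHS]eq_bigr => r _.
  under [X in gE _ X]eq_fun do rewrite prediction_opt//.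
  over.
(* Both losses contain the loss of the gradient step; cancelling it leaves a nonpositive sum of mean
   squared excesses. *)
rewrite big_split /= gerDr => sum_le0.
have ge0 r : 0 <= gE (d * n + d) (fun g => (prediction Vs Ws (X_of d n g) (w_of d n g) r 0 -
    gd_step (X_of d n g) (w_of d n g) r 0) ^+ 2).
  by apply: gE_ge0 => g; exact: sqr_ge0.
have /eqP := le_anti (introT andP (conj sum_le0 (sumr_ge0 _ (fun r _ => ge0 r)))).
rewrite psumr_eq0// => /allP all0.
(* The given data are one sample point, and [gE_eq0] holds at every such point, so equality is not
   merely almost sure. *)
have [g [<- <- gk]] := exists_sample X wstar.
apply/colP => r; apply/eqP; rewrite -subr_eq0 -sqrf_eq0; apply/eqP.
move: g gk; apply: gE_eq0 (eqP (all0 r (mem_index_enum _))).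
- by apply: gpoly_ext (gpolyM (gg Vs Ws r) (gg Vs Ws r)) _ => g; rewrite expr2.
- by move=> g; exact: sqr_ge0.
Qed.
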